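(* Let $Q\subset\mathbb{R}^n$ be a convex compact set and let $\psi:Q\times Q\to\mathbb{R}$ admit a $(\delta,\Delta,L)$-model $\psi_\delta$ (in the sense of the context). Assume the equilibrium problem of finding $x_*\in Q$ with $\psi(x,x_* )\geqslant 0$ for all $x\in Q$ is solvable. After the adaptive method described in the context stops (having performed $N$ iterations), for every $x\in Q$ $$-\frac{1}{S_N}\sum_{k=0}^{N-1}\frac{\psi_\delta(x,y^{k+1})}{L_{k+1}}\leqslant\varepsilon+2\tilde\delta+\delta+\frac{1}{S_N}\sum_{k=0}^{N-1}\frac{\Delta_{k+1}\|y^{k+1}-x^{k+1}\|}{L_{k+1}},$$ and also $$\psi(\tilde y,x)\leqslant\varepsilon+2\tilde\delta+3\delta+\frac{1}{S_N}\sum_{k=0}^{N-1}\frac{\Delta_{k+1}\|y^{k+1}-x^{k+1}\|}{L_{k+1}},\qquad\text{where}\quad \tilde y:=\frac{1}{S_N}\sum_{k=0}^{N-1}\frac{y^{k+1}}{L_{k+1}},\quad S_N:=\sum_{k=0}^{N-1}\frac{1}{L_{k+1}}.$$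
   Context: $\|\cdot\|$ is a norm on $\mathbb{R}^n$. Bregman divergence: $V(y,x)=d(y)-d(x)-\langle\nabla d(x),y-x\rangle$ for $x,y\in Q$, where $d$ is 1-strongly convex and differentiable at all points of $Q$. Model: $\psi$ admits a $(\delta,\Delta,L)$-model $\psi_\delta(x,y)$, for fixed $L,\delta,\Delta>0$, if for all $x,y,z\in Q$: (i) $\psi(x,y)\leqslant\psi_\delta(x,y)+\delta$; (ii) $\psi_\delta(x,y)$ is convex in the first variable and $\psi_\delta(x,x)=0$; (iii) $\psi_\delta(x,y)+\psi_\delta(y,x)\leqslant\delta$; (iv) $\psi_\delta(x,y)\leqslant\psi_\delta(x,z)+\psi_\delta(z,y)+LV(x,z)+LV(z,y)+\Delta\|y-z\|+\delta$. Inexact minimization: for $\tilde\delta\geqslant 0$, $x=\arg\min^{\tilde\delta}_{y\in Q}\varphi(y)$ means $\langle\nabla\varphi(x),x-y\rangle\leqslant\tilde\delta$ for all $y\in Q$ (for a (sub)gradient $\nabla\varphi(x)$). Method. Fix accuracy $\varepsilon>0$, $x^0=\arg\min_{x\in Q}d(x)$, and constants $0<L_0\leqslant 2L$, $0<\Delta_0\leqslant 2\Delta$. The $(N+1)$-th iteration ($N=0,1,2,\dots$): 1. $L_{N+1}:=L_N/2$, $\Delta_{N+1}:=\Delta_N/2$. 2. Compute $y^{N+1}:=\arg\min^{\tilde\delta}_{x\in Q}\{\psi_\delta(x,x^N)+L_{N+1}V(x,x^N)\}$ and $x^{N+1}:=\arg\min^{\tilde\delta}_{x\in Q}\{\psi_\delta(x,y^{N+1})+L_{N+1}V(x,x^N)\}$.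 3. If $$\psi_\delta(x^{N+1},x^N)\leqslant\psi_\delta(y^{N+1},x^N)+\psi_\delta(x^{N+1},y^{N+1})+L_{N+1}V(y^{N+1},x^N)+L_{N+1}V(x^{N+1},y^{N+1})+\Delta_{N+1}\|y^{N+1}-x^{N+1}\|+\delta$$ does not hold, set $L_{N+1}:=2L_{N+1}$, $\Delta_{N+1}:=2\Delta_{N+1}$ and repeat step 2; otherwise go to the next iteration. The method stops after $N$ iterations when $\sum_{k=0}^{N-1}\frac{1}{L_{k+1}}\geqslant\frac{\max_{x\in Q}V(x,x^0)}{\varepsilon}$. *)

(* Defs.v *)
From HB Require Import structures.
From mathcomp Require Import all_boot all_order all_algebra.
From mathcomp Require Import all_classical all_reals all_analysis.

Set Implicit Arguments.
Unset Strict Implicit.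
Unset Printing Implicit Defensive.

Import Order.TTheory GRing.Theory Num.Theory.
Import numFieldNormedType.Exports.

Local Open Scope classical_set_scope.
Local Open Scope ring_scope.

(* 'rV[R]_n carries the sup norm canonically; it only serves to define
   compactness and differentiability, which do not depend on the norm in finite
   dimension. The norm of the problem is an arbitrary function satisfying
   is_norm. *)
Record is_norm (R : realType) (n : nat) (nrm : 'rV[R]_n -> R) : Prop := IsNorm {
  is_norm_eq0 : forall v, nrm v = 0 -> v = 0 ;
  is_normZ : forall (a : R) v, nrm (a *: v) = `|a| * nrm v ;
  is_normD : forall u v, nrm (u + v) <= nrm u + nrm v
}.

Definition dotprod (R : realType) (n : nat) (u v : 'rV[R]_n) : R :=
  \sum_(i < n) u 0 i * v 0 i.

Definition gradient (R : realType) (n : nat) (f : 'rV[R]_n -> R)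
    (x : 'rV[R]_n) : 'rV[R]_n :=
  \row_(i < n) 'D_(delta_mx 0 i) f x.

Definition strongly_convex1 (R : realType) (n : nat) (nrm : 'rV[R]_n -> R)
    (Q : set 'rV[R]_n) (d : 'rV[R]_n -> R) : Prop :=
  forall x y (t : R), Q x -> Q y -> 0 <= t <= 1 ->
    d (t *: x + (1 - t) *: y)
      <= t * d x + (1 - t) * d y - 2^-1 * t * (1 - t) * nrm (x - y) ^+ 2.

Definition bregman (R : realType) (n : nat) (d : 'rV[R]_n -> R)
    (y x : 'rV[R]_n) : R :=
  d y - d x - dotprod (gradient d x) (y - x).

(* Only the values of psi and psid on Q x Q matter. *)
Record is_model (R : realType) (n : nat) (nrm d : 'rV[R]_n -> R)
    (Q : set 'rV[R]_n) (delta Delta L : R)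
    (psi psid : 'rV[R]_n -> 'rV[R]_n -> R) : Prop := IsModel {
  model_upper : forall x y, Q x -> Q y -> psi x y <= psid x y + delta ;
  model_convex : forall y, Q y -> convex_function Q (psid^~ y) ;
  model_diag : forall x, Q x -> psid x x = 0 ;
  model_monotone : forall x y, Q x -> Q y -> psid x y + psid y x <= delta ;
  model_triangle : forall x y z, Q x -> Q y -> Q z ->
    psid x y <= psid x z + psid z y + L * bregman d x z + L * bregman d z y
                + Delta * nrm (y - z) + delta
}.

(* Subgradients of the restriction of phi to Q. *)
Definition subgradient (R : realType) (n : nat) (Q : set 'rV[R]_n)
    (phi : 'rV[R]_n -> R) (x g : 'rV[R]_n) : Prop :=
  forall y, Q y -> phi x + dotprod g (y - x) <= phi y.

Definition is_argmin (R : realType) (n : nat) (Q : set 'rV[R]_n)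
    (phi : 'rV[R]_n -> R) (x : 'rV[R]_n) : Prop :=
  Q x /\ forall y, Q y -> phi x <= phi y.

Definition is_inexact_argmin (R : realType) (n : nat) (tdelta : R)
    (Q : set 'rV[R]_n) (phi : 'rV[R]_n -> R) (x : 'rV[R]_n) : Prop :=
  Q x /\ exists2 g, subgradient Q phi x g &
                    forall y, Q y -> dotprod g (x - y) <= tdelta.

Section Method.
Context (R : realType) (n : nat) (nrm d : 'rV[R]_n -> R) (Q : set 'rV[R]_n).
Context (psid : 'rV[R]_n -> 'rV[R]_n -> R) (delta tdelta eps : R).

(* z is the current iterate; l and D are the trial values of the constants. *)
Definition trial (l : R) (z y x : 'rV[R]_n) : Prop :=
  is_inexact_argmin tdelta Q (fun u => psid u z + l * bregman d u z) y /\
  is_inexact_argmin tdelta Q (fun u => psid u y + l * bregman d u z) x.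

Definition accepted (l D : R) (z y x : 'rV[R]_n) : Prop :=
  psid x z <= psid y z + psid x y + l * bregman d y z + l * bregman d x y
              + D * nrm (y - x) + delta.

(* search z l D y x l' D': steps 2 and 3 started from z with the constants l
   and D end, after finitely many doublings, with the points y and x and the
   constants l' and D'. *)
Inductive search (z : 'rV[R]_n) :
    R -> R -> 'rV[R]_n -> 'rV[R]_n -> R -> R -> Prop :=
| search_accept l D y x :
    trial l z y x -> accepted l D z y x -> search z l D y x l D
| search_reject l D y x y' x' l' D' :
    trial l z y x -> ~ accepted l D z y x ->
    search z (2 * l) (2 * D) y' x' l' D' -> search z l D y' x' l' D'.

Definition Ssum (Ls : nat -> R) (N : nat) : R := \sum_(k < N) (Ls k.+1)^-1.

Definition stopping (x0 : 'rV[R]_n) (Ls : nat -> R) (N : nat) : Prop :=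
  exists2 M, [set bregman d x x0 | x in Q] M /\
             ubound [set bregman d x x0 | x in Q] M &
             M / eps <= Ssum Ls N.

(* A run that stops after exactly N iterations; the test is made only after an
   iteration, so N > 0. The values ys 0, and those beyond index N, are
   irrelevant. *)
Record run_stops_after (xs ys : nat -> 'rV[R]_n) (Ls Ds : nat -> R)
    (N : nat) : Prop := RunStopsAfter {
  run_init : is_argmin Q d (xs 0%N) ;
  run_step : forall k, (k < N)%N ->
    search (xs k) (Ls k / 2) (Ds k / 2)
           (ys k.+1) (xs k.+1) (Ls k.+1) (Ds k.+1) ;
  run_pos : (0 < N)%N ;
  run_stop : stopping (xs 0%N) Ls N ;
  run_continue : forall m, (0 < m < N)%N -> ~ stopping (xs 0%N) Ls m
}.

End Method.

(* Main.v *)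
Require Import Defs.
From mathcomp Require Import all_boot all_order all_algebra.
From mathcomp Require Import all_classical all_reals all_analysis.
From mathcomp Require Import ring lra.

Import Order.TTheory GRing.Theory Num.Theory.
Import numFieldNormedType.Exports.

Set Implicit Arguments.
Unset Strict Implicit.
Unset Printing Implicit Defensive.

Local Open Scope classical_set_scope.
Local Open Scope ring_scope.

(** The proof is the telescoping argument of mirror-prox methods.

    Write [z], [y], [x] for x^k, y^{k+1}, x^{k+1} and [l], [D] for the accepted
    constants. An inexact minimizer [w] of a convex function plus
    l V(., z) satisfies a prox inequality ([inexact_prox]) which is stronger
    than the comparison of values: it has the additional term l V(u, w) on the
    smaller side. It is used for [y] against the competitor [x] and for [x]
    against an arbitrary competitor [u]; adding the two, the acceptance test
    cancels every value of the model but psi_delta(u, y) and every divergence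
    but those of [u] ([step_bound]):
    (- psi_delta(u, y)) / l <= V(u, z) - V(u, x)
                                + (2 tdelta + delta) / l + D |y - x| / l.
    The divergences of [u] telescope over the iterations; the last one is
    nonnegative and can be dropped ([run_bound]), and the first one is at most
    eps S_N by the stopping rule. Division by S_N gives the first claim.

    The second claim follows from the first: psi is at most psi_delta + delta,
    Jensen's inequality ([jensen]) moves psi_delta(., x) inside the weighted
    mean of the y^{k+1}, and the monotonicity of the model bounds
    psi_delta(y^{k+1}, x) by delta - psi_delta(x, y^{k+1}). *)

(** * Convex combinations *)

Lemma sumr_ord_gt0 (R : realFieldType) (w : nat -> R) (N : nat) :
  (0 < N)%N -> (forall k, (k < N)%N -> 0 < w k) -> 0 < \sum_(k < N) w k.
Proof.
case: N => // N _ hw; rewrite big_ord_recl ltr_wpDr ?hw// sumr_ge0// => i _.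
by rewrite ltW// hw// ltnS ltn_ord.
Qed.

Lemma convex_set_comb (R : realFieldType) (E : lmodType R) (Q : set E)
    (hQ : convex_set Q) (x y : E) (t : R) (t01 : 0 <= t <= 1) :
  Q x -> Q y -> Q (t *: x + (1 - t) *: y).
Proof.
move: (t01) => /andP[t0 t1] Qx Qy; have := hQ x y (Itv01 t0 t1).
by rewrite !inE; exact.
Qed.

Lemma convex_function_comb (R : realFieldType) (E : lmodType R) (Q : set E)
    (f : E -> R) (hf : convex_function Q f) (x y : E) (t : R)
    (t01 : 0 <= t <= 1) :
  Q x -> Q y -> f (t *: x + (1 - t) *: y) <= t * f x + (1 - t) * f y.
Proof.
move: (t01) => /andP[t0 t1] Qx Qy.
by have := hf (Itv01 t0 t1) x y; rewrite !inE; exact.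
Qed.

(** By induction on the number of points: the mean of N + 1 points is the
    convex combination, with ratio W / (W + w_N), of the mean of the first N
    points, of total weight W, and the last one. *)
Lemma jensen (R : realFieldType) (E : lmodType R) (Q : set E)
    (hQ : convex_set Q) (f : E -> R) (hf : convex_function Q f)
    (w : nat -> R) (p : nat -> E) (N : nat) (N0 : (0 < N)%N)
    (hw : forall k, (k < N)%N -> 0 < w k) (hp : forall k, (k < N)%N -> Q (p k)) :
  let W := \sum_(k < N) w k in
  let m := W^-1 *: \sum_(k < N) w k *: p k in
  Q m /\ f m <= W^-1 * \sum_(k < N) w k * f (p k).
Proof.
case: N N0 hw hp => // N _; elim: N => [|N IH] hw hp /=.
  rewrite !big_ord1 scalerA mulrA mulVf ?gt_eqF ?hw// scale1r mul1r.
  by split=> //; exact: hp.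
have [Qm fm] := IH (fun k h => hw k (ltnW h)) (fun k h => hp k (ltnW h)).
rewrite !(big_ord_recr N.+1)/=.
set W := \sum_(k < N.+1) w k in Qm fm *.
set P := \sum_(k < N.+1) _ *: _ in Qm fm *.
set F := \sum_(k < N.+1) _ * _ in Qm fm *.
have W0 : 0 < W by apply: sumr_ord_gt0 => // k kN; exact/hw/ltnW.
have w0 : 0 < w N.+1 by exact: hw.
have W'0 : 0 < W + w N.+1 by exact: addr_gt0.
pose t := W / (W + w N.+1).
have t01 : 0 <= t <= 1.
  rewrite /t ler_pdivrMr// mul1r lerDl (ltW w0) andbT.
  by rewrite divr_ge0// ltW.
have t1 : 1 - t = w N.+1 / (W + w N.+1) by rewrite /t; field; rewrite gt_eqF.
have Qp : Q (p N.+1) by exact: hp.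
have -> : (W + w N.+1)^-1 *: (P + w N.+1 *: p N.+1)
    = t *: (W^-1 *: P) + (1 - t) *: p N.+1.
  rewrite scalerDr !scalerA t1; congr (_ *: _ + _ *: _); last exact: mulrC.
  by rewrite /t; field; rewrite !gt_eqF.
split; first exact: convex_set_comb.
apply: (le_trans (convex_function_comb hf t01 Qm Qp)).
have -> : (W + w N.+1)^-1 * (F + w N.+1 * f (p N.+1))
    = t * (W^-1 * F) + (1 - t) * f (p N.+1).
  by rewrite t1 /t; field; rewrite !gt_eqF.
by rewrite lerD2r ler_wpM2l//; case/andP: t01.
Qed.

Lemma segmentE (R : realFieldType) (E : lmodType R) (x y : E) (t : R) :
  x + t *: (y - x) = t *: y + (1 - t) *: x.
Proof. by rewrite scalerBr scalerBl scale1r addrC addrAC addrA. Qed.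

(** * Gradients and directional derivatives *)

Lemma dotprodDr (R : realType) (n : nat) (u v w : 'rV[R]_n) :
  dotprod u (v + w) = dotprod u v + dotprod u w.
Proof.
rewrite /dotprod -big_split/=; apply: eq_bigr => i _.
by rewrite mxE mulrDr.
Qed.

Lemma dotprodZr (R : realType) (n : nat) (a : R) (u v : 'rV[R]_n) :
  dotprod u (a *: v) = a * dotprod u v.
Proof.
by rewrite /dotprod mulr_sumr; apply: eq_bigr => i _; rewrite mxE mulrCA.
Qed.

Lemma dotprodBr (R : realType) (n : nat) (u v w : 'rV[R]_n) :
  dotprod u (v - w) = dotprod u v - dotprod u w.
Proof. by rewrite dotprodDr -scaleN1r dotprodZr mulN1r. Qed.

(** The gradient is a vector of partial derivatives; by differentiability it
    computes the derivative in every direction. The limit is taken on the right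
    because only points of a segment starting at [x] will be known to lie in
    the convex set. *)
Lemma gradient_cvg (R : realType) (n : nat) (f : 'rV[R]_n -> R)
    (x v : 'rV[R]_n) (df : differentiable f x) :
  h^-1 * (f (x + h *: v) - f x) @[h --> 0^'+] --> dotprod (gradient f x) v.
Proof.
have -> : dotprod (gradient f x) v = 'D_v f x.
  rewrite deriveE// [in RHS](row_sum_delta v) linear_sum /dotprod.
  apply: eq_bigr => i _; rewrite linearZ mxE deriveE//=.
  by rewrite mulrC.
apply: cvg_dnbhs_at_right.
have cv : h^-1 *: ((f \o shift x) (h *: v) - f x) @[h --> 0^'] --> 'D_v f x.
  exact: diff_derivable.
apply: cvg_trans cv; apply: near_eq_cvg; near=> h.
by rewrite /= [h *: v + x]addrC.
Unshelve. all: by end_near. Qed.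

Lemma gradient_ge (R : realType) (n : nat) (f : 'rV[R]_n -> R)
    (x v : 'rV[R]_n) (c : R) (df : differentiable f x) :
  (forall t, 0 < t <= 1 -> t * c <= f (x + t *: v) - f x) ->
  c <= dotprod (gradient f x) v.
Proof.
move=> hc; have cv := gradient_cvg (v := v) df.
rewrite -(cvg_lim _ cv)//; apply: limr_ge;
  first by apply/cvg_ex; exists (dotprod (gradient f x) v).
near=> t.
have t0 : 0 < t by [].
rewrite mulrC ler_pdivlMr// mulrC hc// t0/=.
by near: t; exact: nbhs_right_le.
Unshelve. all: by end_near. Qed.

Lemma gradient_le (R : realType) (n : nat) (f : 'rV[R]_n -> R)
    (x v : 'rV[R]_n) (c : R) (df : differentiable f x) :
  (forall t, 0 < t <= 1 -> f (x + t *: v) - f x <= t * c) ->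
  dotprod (gradient f x) v <= c.
Proof.
move=> hc; have cv := gradient_cvg (v := v) df.
rewrite -(cvg_lim _ cv)//; apply: limr_le;
  first by apply/cvg_ex; exists (dotprod (gradient f x) v).
near=> t.
have t0 : 0 < t by [].
rewrite mulrC ler_pdivrMr// [c * _]mulrC hc// t0/=.
by near: t; exact: nbhs_right_le.
Unshelve. all: by end_near. Qed.

Section Method.
Context (R : realType) (n : nat) (nrm : 'rV[R]_n -> R) (Q : set 'rV[R]_n).
Context (hQ : convex_set Q) (d : 'rV[R]_n -> R).
Context (hd : strongly_convex1 nrm Q d).
Context (hdiff : forall x, Q x -> differentiable d x).

(** * Bregman divergence and the prox inequality *)

Lemma bregman_ge0 (x y : 'rV[R]_n) (Qx : Q x) (Qy : Q y) : 0 <= bregman d y x.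
Proof.
rewrite /bregman subr_ge0; apply: gradient_le; first exact: hdiff.
move=> t /andP[t0 t1]; rewrite segmentE.
have t01 : 0 <= t <= 1 by rewrite t1 ltW.
have := hd Qy Qx t01.
have : 0 <= 2^-1 * t * (1 - t) * nrm (y - x) ^+ 2.
  rewrite mulr_ge0 ?sqr_ge0// mulr_ge0 ?subr_ge0//.
  by rewrite mulr_ge0 ?invr_ge0 ?ltW.
by lra.
Qed.

Lemma bregman_three_points (x y z : 'rV[R]_n) :
  bregman d y z - bregman d y x - bregman d x z =
  dotprod (gradient d x) (y - x) - dotprod (gradient d z) (y - x).
Proof. by rewrite /bregman !dotprodBr; ring. Qed.

(** The subgradient inequality alone, at the competitor [u], loses the term
    l V(u, x). It is recovered by applying that inequality at x + t (u - x),
    dividing by [t] and letting [t] tend to 0: the linear part in [t] involves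
    the gradient of [d] at [x], and the three-point identity turns it into
    divergences. *)
Lemma inexact_prox (f : 'rV[R]_n -> R) (hf : convex_function Q f)
    (tdelta l : R) (l0 : 0 < l) (z x : 'rV[R]_n)
    (hx : is_inexact_argmin tdelta Q (fun u => f u + l * bregman d u z) x)
    (u : 'rV[R]_n) (Qu : Q u) :
  f x + l * bregman d x z + l * bregman d u x
    <= f u + l * bregman d u z + tdelta.
Proof.
case: hx => Qx [g sg gx].
(* The inequality to prove, solved for the derivative of d at x towards u. *)
pose c := (f x - f u - tdelta) / l + dotprod (gradient d z) (u - x).
suff : c <= dotprod (gradient d x) (u - x).
  rewrite /c -lerBrDr ler_pdivrMr// -bregman_three_points.
  by lra.
apply: gradient_ge; first exact: hdiff.
move=> t /andP[t0 t1].
have t01 : 0 <= t <= 1 by rewrite t1 ltW.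
have Qt : Q (x + t *: (u - x)) by rewrite segmentE; exact: convex_set_comb.
have ft : f (x + t *: (u - x)) <= t * f u + (1 - t) * f x.
  by rewrite segmentE; exact: convex_function_comb.
have := sg _ Qt; rewrite [x + t *: _ - x]addrAC subrr add0r dotprodZr.
have tg : - (t * tdelta) <= t * dotprod g (u - x).
  rewrite -mulrN ler_pM2l//.
  by have := gx u Qu; rewrite !dotprodBr; lra.
rewrite /bregman [x + t *: _ - z]addrAC.
rewrite [dotprod _ (_ + t *: _)]dotprodDr dotprodZr -(ler_pM2l l0) /c.
have -> : l * (t * ((f x - f u - tdelta) / l + dotprod (gradient d z) (u - x)))
  = t * (f x - f u - tdelta) + l * (t * dotprod (gradient d z) (u - x)).
  by field; rewrite gt_eqF.
by nra.
Qed.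

(** * The iterations *)

Context (psid : 'rV[R]_n -> 'rV[R]_n -> R) (delta tdelta : R).
Context (hpsid : forall y, Q y -> convex_function Q (psid^~ y)).

Lemma search_spec (z : 'rV[R]_n) (l D : R) (y x : 'rV[R]_n) (l' D' : R) :
  search nrm d Q psid delta tdelta z l D y x l' D' -> 0 < l ->
  [/\ 0 < l', trial d Q psid tdelta l' z y x &
      accepted nrm d psid delta l' D' z y x].
Proof.
elim=> {}l {}D {}y {}x => [|y' x' {}l' {}D' _ _ _ IH l0] //.
by apply: IH; rewrite mulr_gt0.
Qed.

Lemma step_bound (z y x u : 'rV[R]_n) (l D : R) (l0 : 0 < l) (Qz : Q z)
    (ht : trial d Q psid tdelta l z y x)
    (ha : accepted nrm d psid delta l D z y x) (Qu : Q u) :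
  - (psid u y / l) <= bregman d u z - bregman d u x
                      + (2 * tdelta + delta) / l + D * nrm (y - x) / l.
Proof.
case: ht => hy hx; have Qy := hy.1; have Qx := hx.1.
have hyx := inexact_prox (hpsid Qz) l0 hy Qx.
have hxu := inexact_prox (hpsid Qy) l0 hx Qu.
move: ha; rewrite /accepted => ha.
rewrite -(ler_pM2l l0).
have -> : l * - (psid u y / l) = - psid u y by field; rewrite gt_eqF.
have -> : l * (bregman d u z - bregman d u x + (2 * tdelta + delta) / l
    + D * nrm (y - x) / l) = l * bregman d u z - l * bregman d u x
    + 2 * tdelta + delta + D * nrm (y - x) by field; rewrite gt_eqF.
by lra.
Qed.

Context (xs ys : nat -> 'rV[R]_n) (Ls Ds : nat -> R) (N : nat).
Context (Q0 : Q (xs 0%N)) (L0 : 0 < Ls 0%N).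
Context (hs : forall k, (k < N)%N ->
  search nrm d Q psid delta tdelta (xs k) (Ls k / 2) (Ds k / 2)
         (ys k.+1) (xs k.+1) (Ls k.+1) (Ds k.+1)).

Lemma run_spec (k : nat) (kN : (k < N)%N) :
  [/\ 0 < Ls k.+1, Q (xs k),
      trial d Q psid tdelta (Ls k.+1) (xs k) (ys k.+1) (xs k.+1) &
      accepted nrm d psid delta (Ls k.+1) (Ds k.+1) (xs k) (ys k.+1) (xs k.+1)].
Proof.
elim: k kN => [|k IH] kN.
  by have [|? ? ?] := search_spec (hs kN); first by rewrite divr_gt0.
have [Lk _ [_ [Qk _]] _] := IH (ltnW kN).
by have [|? ? ?] := search_spec (hs kN); first by rewrite divr_gt0.
Qed.

Lemma run_bound (u : 'rV[R]_n) (Qu : Q u) :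
  - (\sum_(k < N) psid u (ys k.+1) / Ls k.+1) <=
    bregman d u (xs 0%N) + (2 * tdelta + delta) * Ssum Ls N
    + \sum_(k < N) Ds k.+1 * nrm (ys k.+1 - xs k.+1) / Ls k.+1.
Proof.
have hsum : \sum_(k < N) - (psid u (ys k.+1) / Ls k.+1) <=
    \sum_(k < N) (- (bregman d u (xs k.+1) - bregman d u (xs k))
      + (2 * tdelta + delta) / Ls k.+1
      + Ds k.+1 * nrm (ys k.+1 - xs k.+1) / Ls k.+1).
  apply: ler_sum => k _; have [l0 Qk ht ha] := run_spec (ltn_ord k).
  by rewrite opprB; exact: step_bound.
move: hsum; rewrite sumrN !big_split/= -mulr_sumr sumrN.
rewrite -(big_mkord xpredT
  (fun k => bregman d u (xs k.+1) - bregman d u (xs k))).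
rewrite telescope_sumr// => hsum.
have QN : Q (xs N).
  have [N0|] := posnP N; first by rewrite N0.
  move=> N0; have kN : (N.-1 < N)%N by rewrite prednK.
  by have [_ _ [_ []]] := run_spec kN; rewrite prednK.
have := bregman_ge0 QN Qu.
by rewrite /Ssum; lra.
Qed.

End Method.

(** * Convergence rate *)

Theorem mainTheorem3 (R : realType) (n : nat)
    (nrm : 'rV[R]_n -> R) (hnrm : is_norm nrm)
    (Q : set 'rV[R]_n) (hQconvex : convex_set Q) (hQcompact : compact Q)
    (d : 'rV[R]_n -> R) (hdconvex : strongly_convex1 nrm Q d)
    (hddiff : forall x, Q x -> differentiable d x)
    (delta Delta L : R) (hdelta : 0 < delta) (hDelta : 0 < Delta) (hL : 0 < L)
    (psi psid : 'rV[R]_n -> 'rV[R]_n -> R)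
    (hmodel : is_model nrm d Q delta Delta L psi psid)
    (hsolvable : exists2 xstar, Q xstar & forall x, Q x -> 0 <= psi x xstar)
    (tdelta eps : R) (htdelta : 0 <= tdelta) (heps : 0 < eps)
    (xs ys : nat -> 'rV[R]_n) (Ls Ds : nat -> R) (N : nat)
    (hL0 : 0 < Ls 0%N <= 2 * L) (hDelta0 : 0 < Ds 0%N <= 2 * Delta)
    (hrun : run_stops_after nrm d Q psid delta tdelta eps xs ys Ls Ds N)
    (x : 'rV[R]_n) (hx : Q x) :
  let S := Ssum Ls N in
  let ytilde := S^-1 *: \sum_(k < N) (Ls k.+1)^-1 *: ys k.+1 in
  let err := S^-1 * \sum_(k < N) Ds k.+1 * nrm (ys k.+1 - xs k.+1) / Ls k.+1 in
  - (S^-1 * \sum_(k < N) psid x (ys k.+1) / Ls k.+1)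
    <= eps + 2 * tdelta + delta + err
  /\ psi ytilde x <= eps + 2 * tdelta + 3 * delta + err.
Proof.
move=> S ytilde err.
case: hrun => -[Q0 _] hs N0 [M [_ ubM] MS] _.
have [L0 _] := andP hL0.
have spec := run_spec Q0 L0 hs.
have w0 k (kN : (k < N)%N) : 0 < (Ls k.+1)^-1.
  by rewrite invr_gt0; case: (spec k kN).
have Qy k (kN : (k < N)%N) : Q (ys k.+1) by have [_ _ [[]]] := spec k kN.
have S0 : 0 < S by exact: (sumr_ord_gt0 (w := fun k => (Ls k.+1)^-1)).
have claim1 : - (S^-1 * \sum_(k < N) psid x (ys k.+1) / Ls k.+1)
    <= eps + 2 * tdelta + delta + err.
  have hM : bregman d x (xs 0%N) <= eps * S.
    apply: (le_trans (ubM _ _)); first by exists x.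
    by rewrite mulrC -ler_pdivrMr.
  rewrite -mulrN -(ler_pM2l S0) mulVKf ?gt_eqF// mulrDr mulVKf ?gt_eqF//.
  have := run_bound hQconvex hdconvex hddiff (model_convex hmodel) Q0 L0 hs hx.
  by rewrite -/S; lra.
split=> //.
have [Qyt hyt] := jensen hQconvex (model_convex hmodel hx)
  (w := fun k => (Ls k.+1)^-1) (p := fun k => ys k.+1) N0 w0 Qy.
apply: (le_trans (model_upper hmodel Qyt hx)).
suff : S^-1 * \sum_(k < N) (Ls k.+1)^-1 * psid (ys k.+1) x <=
    delta - S^-1 * \sum_(k < N) psid x (ys k.+1) / Ls k.+1.
  by rewrite -/(Ssum Ls N) -/S -/ytilde in hyt *; lra.
rewrite -(ler_pM2l S0) mulrBr !mulVKf ?gt_eqF// lerBrDr.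
rewrite -big_split/= /S /Ssum mulr_suml; apply: ler_sum => k _.
rewrite [psid x _ * _]mulrC -mulrDr ler_pM2l ?w0//.
by rewrite addrC (model_monotone hmodel)//; exact: Qy.
Qed.
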